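(* Let $A\subset\mathbb{R}^2$ be a regular compact set such that the interior $\mathrm{int}\,A$ has finitely many connected components. Assume that there exist $u\in\mathbb{S}^1$ and $a_1,a_2\in\mathrm{int}\,A$ such that $A|u^\perp$ is a segment and the segment $[a_1,a_2]$ is parallel to $u$ and meets $\mathbb{R}^2\setminus A$. Then $g_A\neq g_K$ for every convex body $K$ in $\mathbb{R}^2$.
   Context: A closed set is regular if it coincides with the closure of its interior. For a compact set $A\subset\mathbb{R}^2$, the covariogram is $g_A(x)=\lambda_2(A\cap(A+x))$, $x\in\mathbb{R}^2$, where $\lambda_2$ is Lebesgue measure. A convex body is a compact convex set with non-empty interior. For $u\in\mathbb{S}^1$ (the unit circle), $u^\perp$ is the line through the origin orthogonal to $u$, and $A|u^\perp$ is the orthogonal projection of $A$ on $u^\perp$. *)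

(* Defs.v *)
From HB Require Import structures.
From mathcomp Require Import all_boot all_order all_algebra.
From mathcomp Require Import all_classical all_reals all_analysis.

Set Implicit Arguments.
Unset Strict Implicit.
Unset Printing Implicit Defensive.

Import Order.TTheory GRing.Theory Num.Theory.
Import numFieldNormedType.Exports.

Local Open Scope classical_set_scope.
Local Open Scope ring_scope.

(* The plane is R * R for R : realType.  The library norm on R * R is the max
   norm (it induces the usual topology); Euclidean notions are expressed
   through the inner product instead. *)
Definition dotp (R : realType) (x y : R * R) : R := x.1 * y.1 + x.2 * y.2.

Definition unit_circle (R : realType) : set (R * R) :=
  [set u | dotp u u = 1].

Definition perp (R : realType) (u : R * R) : set (R * R) :=
  [set y | dotp y u = 0].

Definition orth_proj (R : realType) (A L : set (R * R)) : set (R * R) :=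
  [set y | L y /\ exists2 x, A x & forall z, L z -> dotp (x - y) z = 0].

Definition segment (R : realType) (a b : R * R) : set (R * R) :=
  [set (1 - t) *: a + t *: b | t in `[0, 1]].

Definition is_segment (R : realType) (S : set (R * R)) : Prop :=
  exists a b, S = segment a b.

Definition parallel (R : realType) (v u : R * R) : Prop :=
  exists t : R, v = t *: u.

Definition regular (T : topologicalType) (A : set T) : Prop :=
  closed A /\ A = closure (interior A).

Definition components (T : topologicalType) (B : set T) : set (set T) :=
  [set connected_component B x | x in B].

Definition translate (R : realType) (A : set (R * R)) (x : R * R) :
  set (R * R) := [set a + x | a in A].

Definition covariogram (R : realType) (A : set (R * R)) : R * R -> \bar R :=
  fun x => (lebesgue_measure \x lebesgue_measure)%E (A `&` translate A x).

Definition convex_body (R : realType) (K : set (R * R)) : Prop :=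
  [/\ compact K, convex_set K & interior K !=set0].

(* Main.v *)
(* Let [n] be orthogonal to [u], and suppose [g_A = g_K] with [K] convex.  The
   difference [g_A 0 - g_A (t u)] is the area of [A \ (A + t u)]; sliced along
   the lines parallel to [u] and divided by [t], its limit inferior as [t -> 0]
   counts, by Fatou's lemma, at least the intervals in which the lines meet [A].
   For [K] each line contributes at most [1], so the quotient is at most the
   width of [K] along [n], which is at most the width [l] of [A] since the
   support of [g_K] is [K - K] while [g_A] vanishes outside [A - A].  For [A],
   the projection of its interior has full measure [l] in the segment
   [A | u^perp] (by finiteness of the components), and the lines near [a1 a2]
   count twice, so the limit inferior exceeds [l].  Slicing uses the area-preserving
   coordinates of [adapted_coordinates], a shear in place of a rotation. *)
Require Import Defs.
From HB Require Import structures.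
From mathcomp Require Import all_boot all_order all_algebra.
From mathcomp Require Import all_classical all_reals all_analysis.
From mathcomp Require Import measurable_realfun.
From mathcomp Require Import lra ring.
Import Order.TTheory GRing.Theory Num.Theory.
Import numFieldNormedType.Exports.
Local Open Scope classical_set_scope.
Local Open Scope ring_scope.

Set Implicit Arguments.
Unset Strict Implicit.
Unset Printing Implicit Defensive.

(** * Subsets of the line and their translates *)

Lemma measurable_shift (R : realType) (S : set R) (t : R) :
  measurable S -> measurable ((fun s => s + t) @^-1` S).
Proof.
move=> mS; rewrite -[_ @^-1` _]setTI; exact: measurable_funD.
Qed.

Lemma lebesgue_measure_shift (R : realType) (S : set R) (t : R) :
  measurable S ->
  lebesgue_measure ((fun s => s + t) @^-1` S) = lebesgue_measure S :> \bar R.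
Proof.
move=> mS.
have mf : measurable_fun setT
    ((fun s => s + t) : measurableTypeR R -> measurableTypeR R).
  exact: measurable_funD.
have -> : lebesgue_measure ((fun s => s + t) @^-1` S) =
    pushforward lebesgue_measure
      ((fun s => s + t) : measurableTypeR R -> measurableTypeR R) S by [].
apply/esym.
have mfM := isMeasurableFun.Build _ _ _ _ _ mf.
pose f : {mfun measurableTypeR R >-> measurableTypeR R} :=
  HB.pack ((fun s => s + t) : measurableTypeR R -> measurableTypeR R) mfM.
apply: (@lebesgue_measure_unique R (pushforward lebesgue_measure f)) => //.
move=> _ [[a b]] _ <-.
rewrite /pushforward.
rewrite [X in _ = lebesgue_measure X](_ : _ = `](a - t), (b - t)]%classic); last first.
  by apply/seteqP; split => s /=; rewrite !in_itv/= ltrBlDr lerBrDr.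
rewrite /= !lebesgue_measure_itv/= !lte_fin ltrD2r.
by case: ifP => // _; rewrite -!EFinB; congr (_%:E); ring.
Qed.

(** This is [S] minus its translate by [t]. For [S] of finite measure, its measure is the drop of
    the one-dimensional covariogram of [S] between [0] and [t]. *)
Definition advance (R : realType) (t : R) (S : set R) : set R :=
  S `\` (fun s => s - t) @^-1` S.

Lemma measurable_advance (R : realType) (I : set R) (t : R) :
  measurable I -> measurable (advance t I).
Proof. by move=> mI; apply: measurableD => //; exact: measurable_shift. Qed.

(* Cutting [S] at the right end [a + t] of the interval leaves
   [l(S') - l(S' `&` (S' + t)) >= l(]a, a + t])]. *)
Lemma le_measure_advance (R : realType) (S : set R) (a t : R) :
  measurable S -> (lebesgue_measure S < +oo)%E -> 0 < t ->
  `[a, a + t] `<=` S ->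
  (t%:E <= lebesgue_measure (advance t S))%E.
Proof.
rewrite /advance.
move=> mS Sfin t0 aS.
pose S' := S `&` `]-oo, a + t]%classic.
have mS' : measurable S' by apply: measurableI.
have S'fin : (lebesgue_measure S' < +oo)%E.
  by apply: le_lt_trans Sfin; apply: le_measure; rewrite ?inE//; exact: subIsetl.
have mT := measurable_shift (- t) mS.
have mT' := measurable_shift (- t) mS'.
apply: (@le_trans _ _ (lebesgue_measure (S' `\` (fun s => (s - t)%R) @^-1` S'))); last first.
  apply: le_measure; rewrite ?inE; [exact: measurableD|exact: measurableD|].
  move=> s [[Ss /=]]; rewrite in_itv/= => sa nS; split=> //= Sst; apply: nS.
  split=> //=; rewrite in_itv/=; lra.
have -> : S' `\` (fun s => (s - t)%R) @^-1` S' = S' `\` (S' `&` (fun s => (s - t)%R) @^-1` S').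
  by rewrite setDIr setDv set0U.
rewrite measureD//; last exact: measurableI.
rewrite setIA setIid.
set P := S' `&` `]-oo, a]%classic.
have mP : measurable P by apply: measurableI.
have Pfin : (lebesgue_measure P < +oo)%E.
  by apply: le_lt_trans S'fin; apply: le_measure; rewrite ?inE//; exact: subIsetl.
(* Moved back by [t], a common point of [S'] and its translate lands in [S'] at or below [a]. *)
have le1 : (lebesgue_measure (S' `&` (fun s => (s - t)%R) @^-1` S') <= lebesgue_measure P)%E.
  rewrite -(@lebesgue_measure_shift _ _ t); last exact: measurableI.
  apply: le_measure; rewrite ?inE//; first by apply: measurable_shift; exact: measurableI.
  move=> s /= []; rewrite addrK => -[_ /=]; rewrite in_itv/= => sat S's.
  split=> //=; rewrite in_itv/=; lra.
have ES' : lebesgue_measure S' = (lebesgue_measure P + t%:E)%E.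
  have -> : S' = P `|` `]a, a + t]%classic.
    apply/seteqP; split => s.
      move=> S's; have [sa|sa] := leP s a; [left|right] => /=.
        by split => //=; rewrite in_itv.
      by case: S's => _ /=; rewrite !in_itv/= sa.
    case; first by case.
    rewrite /= in_itv/= => /andP[sa sat]; split; last by rewrite /= in_itv.
    by apply: aS; rewrite /= in_itv/= sat ltW.
  rewrite measureU//.
    by rewrite /= lebesgue_measure_itv/= lte_fin ltrDl t0 -EFinB [a + t]addrC addrK.
  apply/seteqP; split => // s [[_ /=]]; rewrite !in_itv/= => sa /andP[+ _].
  by rewrite ltNge sa.
have fP : lebesgue_measure P \is a fin_num by rewrite ge0_fin_numE.
rewrite leeBrDr//.
  by rewrite [leRHS]ES' addeC leeD2r.
by rewrite ge0_fin_numE// (le_lt_trans le1 Pfin).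
Qed.

(** Cut [S] at [p]. Because of the gap below [p], the translation carries no point of [S] from below
    [p] to [p] or beyond, so the advances of the two halves are disjoint parts of that of [S], each
    of measure at least [t]. *)
Lemma le_measure_advance2 (R : realType) (S : set R) (a b p t : R) :
  measurable S -> (lebesgue_measure S < +oo)%E -> 0 < t ->
  `[a, a + t] `<=` S -> `[b, b + t] `<=` S ->
  a + t < p -> p <= b -> (forall s, p - t <= s < p -> ~ S s) ->
  ((2 * t)%R%:E <= lebesgue_measure (advance t S))%E.
Proof.
rewrite /advance.
move=> mS Sfin t0 aS bS ap pb gap.
pose S1 := S `&` `]-oo, p[%classic; pose S2 := S `&` `[p, +oo[%classic.
have mS1 : measurable S1 by apply: measurableI.
have mS2 : measurable S2 by apply: measurableI.
have mT := measurable_shift (- t) mS.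
have mT1 := measurable_shift (- t) mS1.
have mT2 := measurable_shift (- t) mS2.
have S1fin : (lebesgue_measure S1 < +oo)%E.
  by apply: le_lt_trans Sfin; apply: le_measure; rewrite ?inE//; exact: subIsetl.
have S2fin : (lebesgue_measure S2 < +oo)%E.
  by apply: le_lt_trans Sfin; apply: le_measure; rewrite ?inE//; exact: subIsetl.
have H1 : (t%:E <= lebesgue_measure (S1 `\` (fun s => (s - t)%R) @^-1` S1))%E.
  apply: (@le_measure_advance _ _ a) => //.
  move=> s sI; split; first exact: aS.
  by move: sI; rewrite /= !in_itv/= => /andP[_ sa]; apply: le_lt_trans ap.
have H2 : (t%:E <= lebesgue_measure (S2 `\` (fun s => (s - t)%R) @^-1` S2))%E.
  apply: (@le_measure_advance _ _ b) => //.
  move=> s sI; split; first exact: bS.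
  by move: sI; rewrite /= !in_itv/= andbT => /andP[+ _]; exact: le_trans.
have -> : 2 * t = t + t by ring.
rewrite EFinD (le_trans (leeD H1 H2))//.
rewrite -measureU//; [|exact: measurableD|exact: measurableD|].
  apply: le_measure; rewrite ?inE; [|exact: measurableD|].
    by apply: measurableU; exact: measurableD.
  move=> s [[[Ss /=]]|[[Ss /=]]]; rewrite in_itv/= ?andbT => sp nS; split => //= Sst; apply: nS; split => //=; rewrite in_itv/= ?andbT; first by lra.
  rewrite leNgt; apply/negP => stp; apply: gap Sst; lra.
apply/seteqP; split => // s [[[_ /=]]]; rewrite in_itv/= => sp _ [[_ /=]].
by rewrite in_itv/= andbT leNgt sp.
Qed.

(** * Planar Lebesgue measure as a product measure *)

Local Notation lebesgue2 := (lebesgue_measure \x lebesgue_measure)%E.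

(** Links the topology with the product sigma-algebra: an open set is a countable union of products
    of balls with rational centres and radii. *)
Lemma open_measurable_prod (R : realType) (U : set (R * R)) :
  open U -> measurable (U : set (measurableTypeR R * measurableTypeR R)).
Proof.
move=> oU.
pose box (q : rat * rat * rat) : set (R * R) :=
  ball (ratr q.1.1 : R) (ratr q.2) `*` ball (ratr q.1.2 : R) (ratr q.2).
have -> : U = \bigcup_(q in [set q | box q `<=` U]) box q.
  apply/seteqP; split => z; last by move=> [q /= qU qz]; exact: qU.
  move=> Uz; have /nbhs_ballP[e /= e0 eU] : nbhs z U by exact: open_nbhs_nbhs.
  have /rat_in_itvoo[r] : 0 < e / 2 by rewrite divr_gt0.
  rewrite in_itv/= => /andP[r0 re].
  have /rat_in_itvoo[a] : z.1 - ratr r < z.1 + ratr r by lra.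
  rewrite in_itv/= => /andP[a1 a2].
  have /rat_in_itvoo[b] : z.2 - ratr r < z.2 + ratr r by lra.
  rewrite in_itv/= => /andP[b1 b2].
  exists (a, b, r); last by split; rewrite /ball/= ltr_norml; lra.
  move=> x [/=]; rewrite /ball/= !ltr_norml => /andP[x1 x2] /andP[x3 x4].
  by apply: eU; split; rewrite /ball/= ltr_norml; lra.
rewrite bigcup_mkcond; apply: countable_bigcupT_measurable.
  exact: countableP.
move=> q; case: ifP => // _; apply: measurableX; exact: measurable_ball.
Qed.

Lemma closed_measurable_prod (R : realType) (C : set (R * R)) :
  closed C -> measurable (C : set (measurableTypeR R * measurableTypeR R)).
Proof.
by move=> /closed_openC/open_measurable_prod/measurableC; rewrite setCK.
Qed.

Lemma lebesgue2_ball_gt0 (R : realType) (z : R * R) (r : R) :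
  0 < r -> (0 < lebesgue2 (ball z r))%E.
Proof.
move=> r0.
have -> : ball z r = ball z.1 r `*` ball z.2 r by [].
rewrite product_measure1E; [|exact: measurable_ball|exact: measurable_ball].
rewrite /= !lebesgue_measure_ball ?ltW// -EFinM lte_fin.
by rewrite mulr_gt0// mulrn_wgt0.
Qed.

Lemma lebesgue2_bounded (R : realType) (S : set (R * R)) (M : R) :
  measurable (S : set (measurableTypeR R * measurableTypeR R)) ->
  (forall z, S z -> `|z.1| <= M /\ `|z.2| <= M) -> (lebesgue2 S < +oo)%E.
Proof.
move=> mS bS; have mI : measurable (`[- M, M]%classic : set R) by [].
apply: (@le_lt_trans _ _ (lebesgue2 (`[- M, M] `*` `[- M, M]))).
  apply: le_measure; rewrite ?inE//; first exact: measurableX.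
  by move=> z /bS[]; rewrite !ler_norml => ? ?; split; rewrite /= in_itv.
rewrite product_measure1E//= lebesgue_measure_itv/=.
by case: ifP => _; rewrite ?mule0 ?ltry//; exact: ltry.
Qed.

(** Swapping gives the iterated integral in the other order, and a product measure is determined by
    its values on rectangles. *)
Lemma lebesgue2_swap (R : realType)
    (S : set (measurableTypeR R * measurableTypeR R)) :
  measurable S ->
  measurable ((fun z => (z.2, z.1)) @^-1` S) /\
  lebesgue2 ((fun z => (z.2, z.1)) @^-1` S) = lebesgue2 S :> \bar R.
Proof.
move=> mS.
have mS' : measurable ((fun z : measurableTypeR R * measurableTypeR R =>
    (z.2, z.1)) @^-1` S).
  rewrite -[_ @^-1` _]setTI.
  by apply: (measurable_fun_pair measurable_snd measurable_fst).
split=> //.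
transitivity ((lebesgue_measure \x^ lebesgue_measure)%E S); last first.
  apply/esym/product_measure_unique => // A B mA mB.
  exact: product_measure2E.
rewrite /product_measure1/product_measure2; apply: eq_integral => y _ /=.
congr lebesgue_measure; apply/seteqP; split => s /=;
  by rewrite /xsection /ysection /= !inE.
Qed.

(** Over each [y] the shear is a translation by [m * y], which preserves the measure of the
    section. *)
Lemma lebesgue2_shear (R : realType) (m : R)
    (S : set (measurableTypeR R * measurableTypeR R)) :
  measurable S ->
  measurable ((fun z => (z.1, z.2 + m * z.1)) @^-1` S) /\
  lebesgue2 ((fun z => (z.1, z.2 + m * z.1)) @^-1` S) = lebesgue2 S :> \bar R.
Proof.
move=> mS.
have mS' : measurable ((fun z : measurableTypeR R * measurableTypeR R =>
    (z.1, z.2 + m * z.1) : measurableTypeR R * measurableTypeR R) @^-1` S).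
  rewrite -[_ @^-1` _]setTI.
  apply: measurable_fun_pair => //.
  apply: measurable_funD => //.
  by apply: measurable_funM.
split=> //.
rewrite /product_measure1; apply: eq_integral => y _ /=.
rewrite -[RHS](lebesgue_measure_shift (m * y)); last exact: measurable_xsection.
congr lebesgue_measure; apply/seteqP; split => s /=;
  by rewrite /xsection /= !inE.
Qed.

(** * Sweeping a planar set along the vertical lines *)

Section sweep.
Variable R : realType.
Implicit Types (S : set (measurableTypeR R * measurableTypeR R)) (t : R).

Let vshift t (z : measurableTypeR R * measurableTypeR R) :
  measurableTypeR R * measurableTypeR R := (z.1, z.2 - t).

Let measurable_vshift S t : measurable S -> measurable (vshift t @^-1` S).
Proof.
move=> mS; rewrite -[_ @^-1` _]setTI; apply: measurable_fun_pair => //.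
exact: measurable_funD.
Qed.

Let xsection_vshift S t y :
  xsection (S `\` vshift t @^-1` S) y = advance t (xsection S y).
Proof.
by apply/seteqP; split=> s; rewrite /advance /xsection /= !inE.
Qed.

Lemma measurable_fun_advance S t : measurable S ->
  measurable_fun setT (fun y => lebesgue_measure (advance t (xsection S y))).
Proof.
move=> mS.
rewrite (_ : (fun _ => _) = lebesgue_measure \o xsection (S `\` vshift t @^-1` S)).
  by apply: measurable_fun_xsection; apply: measurableD => //;
    exact: measurable_vshift.
by apply/funext => y; rewrite -xsection_vshift.
Qed.

(** The left side and the first summand are the covariogram of [S] at [0] and at the vertical vector
    of height [t], so the integral is its drop. *)
Lemma lebesgue2_advance S t : measurable S -> (lebesgue2 S < +oo)%E ->
  lebesgue2 S = (lebesgue2 (S `&` (fun z => (z.1, (z.2 - t)%R)) @^-1` S) +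
    \int[lebesgue_measure]_y lebesgue_measure (advance t (xsection S y)))%E.
Proof.
move=> mS Sfin; have mT := measurable_vshift t mS.
have -> : (\int[lebesgue_measure]_y lebesgue_measure (advance t (xsection S y))
    = lebesgue2 (S `\` vshift t @^-1` S))%E.
  by rewrite /product_measure1; apply: eq_integral => y _ /=;
    rewrite xsection_vshift.
rewrite addeC -measureU; [|exact: measurableD|exact: measurableI|].
  by rewrite setUC setUIDK.
by apply/seteqP; split => // z [[_ nz] [_ /nz]].
Qed.

(** If [s] in [I] lies beyond [inf I + t], some point of [I] lies below [s - t], so [s - t] is in
    the interval [I] too. The lower bound makes [inf I] a true infimum. *)
Lemma advance_interval (I : set R) (M t : R) : 0 < t -> is_interval I ->
  measurable I -> (forall s, I s -> - M <= s) ->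
  (lebesgue_measure (advance t I) <= t%:E)%E.
Proof.
move=> t0 itvI mI bI.
apply: (@le_trans _ _ (lebesgue_measure `[inf I, inf I + t]%classic)); last first.
  by rewrite lebesgue_measure_itv/= lte_fin ltrDl t0 -EFinB addrC addKr.
apply: le_measure; rewrite ?inE//; first exact: measurable_advance.
move=> s [Is nIs].
have hI : has_inf I by split; [exists s|exists (- M)].
rewrite /= in_itv/= (ge_inf _ Is)/=; last by case: hI.
rewrite leNgt; apply/negP; rewrite -ltrBrDr => sI; apply: nIs => /=.
have [i Ii iI] := inf_lt hI.1 sI.
by apply: (itvI i s) => //; rewrite (ltW iI)/=; lra.
Qed.

Lemma limn_einf_ge (u : (\bar R)^nat) (c : \bar R) :
  (\forall n \near \oo, c <= u n)%E -> (c <= limn_einf u)%E.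
Proof.
case=> N _ cu; rewrite limn_einf_lim; apply: (@le_trans _ _ (einfs u N)).
  by apply: le_ereal_inf_tmp => _ [n /= Nn <-]; exact: cu.
apply: (@le_trans _ _ (ereal_sup (range (einfs u)))).
  by apply: ereal_sup_ubound; exists N.
by rewrite (cvg_lim _ (@cvg_einfs_sup _ u)).
Qed.

(* [U] and [V] are sets of vertical lines meeting [S] in at least one, resp.
   two, separated intervals: to first order in [t], [advance t] counts them. *)
Lemma sweep_lower_bound S (U V : set R) (l : R) :
  measurable S ->
  (forall y, lebesgue_measure (xsection S y) < +oo)%E ->
  measurable U -> measurable V -> V `<=` U ->
  (forall y, U y -> exists a r, 0 < r /\ `[a, a + r] `<=` xsection S y) ->
  (forall y, V y -> exists a b p r, [/\ 0 < r, a + r < p <= b,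
     `[a, a + r] `<=` xsection S y, `[b, b + r] `<=` xsection S y &
     forall s, p - r <= s < p -> ~ xsection S y s]) ->
  (forall t, (0 < t)%R ->
    \int[lebesgue_measure]_y lebesgue_measure (advance t (xsection S y)) <=
      (t * l)%R%:E)%E ->
  (lebesgue_measure U + lebesgue_measure V <= l%:E)%E.
Proof.
move=> mS Sfin mU mV VU HU HV Hl.
(* Difference quotients along the steps [n.+1%:R^-1], since Fatou's lemma takes a sequence. *)
pose f (n : nat) (y : measurableTypeR R) : \bar R := (n.+1%:R%:E *
  lebesgue_measure (advance n.+1%:R^-1 (xsection S y)))%E.
have mf n : measurable_fun setT (f n).
  by apply: measurable_funeM; exact: measurable_fun_advance.
have f0 n y : setT y -> (0 <= f n y)%E by move=> _; rewrite mule_ge0// lee_fin.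
have intf n : (\int[lebesgue_measure]_y f n y <= l%:E)%E.
  rewrite ge0_integralZl//; last exact: measurable_fun_advance.
  rewrite (le_trans (lee_wpmul2l _ (Hl _ _)))//.
  by rewrite -EFinM mulrA divff ?mul1r.
(* As [V] lies in [U], the integrand is [2] on [V] and [1] on the rest of [U]: the number of
   intervals guaranteed on each line. *)
have -> : (lebesgue_measure U + lebesgue_measure V =
    \int[lebesgue_measure]_y ((\1_U y)%:E + (\1_V y)%:E))%E.
  rewrite ge0_integralD//; last 2 first.
  - exact/measurable_EFinP.
  - exact/measurable_EFinP.
  by rewrite !integral_indic// !setIT.
have small (r : R) : 0 < r -> \forall n \near \oo, (n.+1%:R^-1 : R) < r.
  by move=> r0; exact: near_infty_natSinv_lt (PosNum r0).
apply: (@le_trans _ _ (\int[lebesgue_measure]_y limn_einf (f^~ y))%E).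
  apply: ge0_le_integral => //.
  - by move=> y _; rewrite -EFinD lee_fin addr_ge0.
  - by apply: emeasurable_funD; exact/measurable_EFinP.
  (* Measurability of the limit inferior is obtained by negation from that of the limit superior. *)
  - have -> : (fun y => limn_einf (f^~ y)) = (fun y => - limn_esup (fun n => - f n y))%E by [].
    apply: measurableT_comp => //; apply: measurable_fun_limn_esup => n.
    exact: measurableT_comp.
  move=> y _; apply: limn_einf_ge.
  have [Uy|nUy] := pselect (U y); last first.
    have nVy : ~ V y by move=> /VU.
    by rewrite !indicE !memNset// adde0; apply: nearW => n; exact: f0.
  have scale n (c : R) :
      ((c * n.+1%:R^-1)%:E <= lebesgue_measure (advance n.+1%:R^-1 (xsection S y)))%E
      -> (c%:E <= f n y)%E.
    move=> H; apply: le_trans (lee_wpmul2l _ H) => //.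
    by rewrite -EFinM mulrCA divff ?mulr1.
  have mSy : measurable (xsection S y) by exact: measurable_xsection.
  have [Vy|nVy] := pselect (V y).
    rewrite !indicE !mem_set// -EFinD.
    have [a [b [p [r [r0 /andP[arp pb] ha hb gap]]]]] := HV _ Vy.
    near=> n; have nr : n.+1%:R^-1 < r by near: n; exact: small.
    apply: scale; apply: (@le_measure_advance2 _ _ a b p) => //.
    + by move=> s; rewrite /= in_itv/= => /andP[? sn]; apply: ha;
      rewrite /= in_itv/=; apply/andP; split=> //; apply: (le_trans sn); rewrite lerD2l ltW.
    + by move=> s; rewrite /= in_itv/= => /andP[? sn]; apply: hb;
      rewrite /= in_itv/=; apply/andP; split=> //; apply: (le_trans sn); rewrite lerD2l ltW.
    + by rewrite (le_lt_trans _ arp)// lerD2l ltW.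
    + move=> s /andP[ps sp]; apply: gap; rewrite sp andbT.
      by rewrite (le_trans _ ps)// lerD2l lerN2 ltW.
  rewrite !indicE mem_set// memNset// adde0.
  have [a [r [r0 ha]]] := HU _ Uy.
  near=> n; have nr : n.+1%:R^-1 < r by near: n; exact: small.
  apply: scale; rewrite mul1r; apply: (@le_measure_advance _ _ a) => //.
  by move=> s; rewrite /= in_itv/= => /andP[? sn]; apply: ha;
      rewrite /= in_itv/=; apply/andP; split=> //; apply: (le_trans sn); rewrite lerD2l ltW.
apply: (le_trans (fatou _ _ _ _)) => //.
rewrite limn_einf_lim; apply: lime_le; first exact: is_cvg_einfs.
apply: nearW => n; apply: le_trans (intf n).
by apply: ereal_inf_lbound; exists n => /=.
Unshelve. all: by end_near. Qed.

(** Each section, being an interval, contributes at most [t], and only the lines over an interval of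
    length [l] contribute. *)
Lemma sweep_upper_bound S (k l M : R) t : 0 < t -> 0 <= l -> measurable S ->
  (forall y, is_interval (xsection S y)) ->
  (forall z, S z -> k <= z.1 <= k + l /\ - M <= z.2) ->
  (\int[lebesgue_measure]_y lebesgue_measure (advance t (xsection S y)) <=
    (t * l)%R%:E)%E.
Proof.
move=> t0 l0 mS itvS bS.
apply: (@le_trans _ _ (\int[lebesgue_measure]_y
    (t%:E * (\1_(`[k, k + l]%classic) y)%:E))%E).
  apply: ge0_le_integral => //.
  - exact: measurable_fun_advance.
  - by apply: measurable_funeM; exact/measurable_EFinP.
  move=> y _; rewrite indicE.
  have [yk|yk] := boolP (y \in `[k, k + l]%classic).
    rewrite mule1; apply: (@advance_interval _ M) => //.
      exact: measurable_xsection.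
    by move=> s; rewrite /xsection/= inE => /bS[].
  rewrite mule0 (_ : advance _ _ = set0) ?measure0//.
  apply/seteqP; split=> // s [+ _]; rewrite /xsection/= inE => /bS[/= + _].
  by move=> kl; move: yk; rewrite notin_setE/= in_itv/= kl.
rewrite ge0_integralZl//; last 2 first.
- exact/measurable_EFinP.
- by rewrite lee_fin ltW.
rewrite integral_indic// setIT /= lebesgue_measure_itv/= lte_fin ltrDl EFinM.
have [l1|l1] := ltP 0 l; first by rewrite -EFinB addrC addKr.
by rewrite mule0 mule_ge0 ?lee_fin// ltW.
Qed.

End sweep.

(** * Convex combinations, intervals and continuous images *)

Lemma convex_set_comb (R : realType) (K : set (R * R)) (x y : R * R) (s : R) :
  convex_set K -> K x -> K y -> 0 <= s <= 1 -> K ((1 - s) *: x + s *: y).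
Proof.
move=> cK Kx Ky /andP[s0 s1].
have := cK y x (Itv01 s0 s1); rewrite !inE => /(_ Ky Kx).
by rewrite /conv/= /unstable.onem addrC.
Qed.

(** A limit point outside [J] has all of [J] on one side, so it is [sup J] or [inf J]; [J] is
    bounded on that side, so this is not a default value. *)
Lemma finite_closure_interval (R : realType) (J : set R) :
  is_interval J -> finite_set (closure J `\` J).
Proof.
move=> itvJ; apply: (@sub_finite_set _ _ [set inf J; sup J]); last first.
  exact: finite_set2.
move=> y [cJy nJy].
have Jnear (e : R) : 0 < e -> exists2 j, J j & `|y - j| < e.
  by move=> e0; have [j [Jj yj]] := cJy _ (nbhsx_ballx y e e0); exists j.
have J0 : J !=set0 by have [j Jj _] := Jnear _ ltr01; exists j.
have [[a Ja ay]|nlo] := pselect (exists2 a, J a & a < y).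
  have ub : ubound J y.
    move=> b Jb; rewrite leNgt; apply/negP => yb; apply: nJy.
    by apply: (itvJ a b) => //; rewrite !ltW.
  right; apply/eqP; rewrite eq_le (ge_sup J0 ub) andbT leNgt; apply/negP => sy.
  have /Jnear[j Jj] : 0 < y - sup J by rewrite subr_gt0.
  have := ub_le_sup (ex_intro _ y ub) Jj.
  by rewrite ltr_norml => ? /andP[]; lra.
have lb : lbound J y.
  by move=> a Ja; rewrite leNgt; apply/negP => ay; apply: nlo; exists a.
left; apply/eqP; rewrite eq_le (lb_le_inf J0 lb) /= leNgt; apply/negP => sy.
have /Jnear[j Jj] : 0 < inf J - y by rewrite subr_gt0.
have := ge_inf (ex_intro _ y lb) Jj.
by rewrite ltr_norml => ? /andP[]; lra.
Qed.

(** A finite union of closed sets is closed, so [A] is covered by the closures of the components. A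
    continuous [f] maps each component onto an interval and its closure into the closure of that
    interval, which adds finitely many points. *)
Lemma finite_image_regular (R : realType) (T : topologicalType) (A : set T)
    (f : T -> R) :
  A = closure (interior A) -> finite_set (components (interior A)) ->
  continuous f -> finite_set (f @` A `\` f @` interior A).
Proof.
move=> regA finA cf.
apply: (@sub_finite_set _ _ (\bigcup_(C in components (interior A))
    (closure (f @` C) `\` f @` C))); last first.
  apply: bigcup_finite => // _ [x _ <-]; apply: finite_closure_interval.
  apply/connected_intervalP/connected_continuous_connected.
    exact: component_connected.
  exact: continuous_subspaceT.
move=> _ [[x Ax <-] nfx].
have [C CA Cx] : exists2 C, components (interior A) C & closure C x.
  suff : (\bigcup_(C in components (interior A)) closure C) x.
    by case=> C ? ?; exists C.
  have cl : closed (\bigcup_(C in components (interior A)) closure C).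
    by apply: closed_bigcup => // C _; exact: closed_closure.
  have clx : closure (interior A) x by rewrite -regA.
  apply: cl; apply: closure_subset clx => z Az.
  exists (connected_component (interior A) z); first by exists z.
  by apply: subset_closure; exact: connected_component_refl.
exists C => //; split.
  move=> N Nfx; have [z [Cz Nz]] := Cx _ (cf x _ Nfx).
  by exists (f z); split => //; exists z.
move=> [z Cz zx]; apply: nfx; exists z => //.
by case: CA Cz => z0 _ <-; exact: connected_component_sub.
Qed.

Lemma open_ball_cl (R : realType) (O : set R) (s : R) : open O -> O s ->
  exists2 r, 0 < r & forall x, `|x - s| <= r -> O x.
Proof.
move=> oO Os; have /nbhs_ballP[r /= r0 rO] : nbhs s O by exact: open_nbhs_nbhs.
exists (r / 2); first by rewrite divr_gt0.
move=> x xs; apply: rO; rewrite /ball/= distrC (le_lt_trans xs)//.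
by rewrite ltr_pdivrMr// ltr_pMr// ltr1n.
Qed.

Lemma compact_bound (R : realType) (A : set (R * R)) (f : R * R -> R) :
  compact A -> continuous f -> exists M, forall x, A x -> `|f x| <= M.
Proof.
move=> cA cf; have : compact (f @` A).
  by apply: continuous_compact => //; exact: continuous_subspaceT.
move=> /compact_bounded[M [_ bM]]; exists (M + 1) => x Ax.
by apply: (bM (M + 1)); [rewrite ltrDl|exists x].
Qed.

Lemma image_comb_interval (R : realType) (p q : R) :
  exists a b, a <= b /\
    [set (1 - t) * p + t * q | t in `[0, 1]] = `[a, b]%classic.
Proof.
wlog pq : p q / p <= q.
  move=> H; have [pq|/ltW qp] := leP p q; first exact: H.
  have [a [b [ab E]]] := H _ _ qp; exists a, b; split=> //; rewrite -E.
  by apply/seteqP; split=> _ [t /= + <-]; rewrite in_itv/= => t01;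
    exists (1 - t); rewrite ?in_itv/=; [lra|ring|lra|ring].
exists p, q; split => //; apply/seteqP; split => y /=.
  by move=> [t]; rewrite !in_itv/= => t01 <-; apply/andP; split; nra.
rewrite in_itv/= => /andP[py yq].
have [qp|qp] := eqVneq q p.
  by exists 0; rewrite ?in_itv/= ?lexx ?ler01//; lra.
have qp0 : 0 < q - p by rewrite subr_gt0 lt_neqAle eq_sym qp.
exists ((y - p) / (q - p)).
  by rewrite in_itv/= divr_ge0 ?ler_pdivrMr ?mul1r ?lerD2r ?subr_ge0// ltW.
by field; rewrite gt_eqF.
Qed.

(** * Translates, inner products and widths *)

Lemma translateE (R : realType) (A : set (R * R)) (x : R * R) :
  translate A x = (fun z => z - x) @^-1` A.
Proof.
apply/seteqP; split=> [_ [z Az <-]|z Az] /=; first by rewrite addrK.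
by exists (z - x) => //; rewrite subrK.
Qed.

Lemma closed_translate (R : realType) (A : set (R * R)) (x : R * R) :
  closed A -> closed (translate A x).
Proof.
move=> cA; rewrite translateE; apply: closed_comp => // z _.
by apply: cvgB; [exact: cvg_id|exact: cvg_cst].
Qed.

Lemma dotpC (R : realType) (x y : R * R) : dotp x y = dotp y x.
Proof. by rewrite /dotp; ring. Qed.

Lemma dotpDl (R : realType) (x y n : R * R) :
  dotp (x + y) n = dotp x n + dotp y n.
Proof.
by transitivity ((x.1 + y.1) * n.1 + (x.2 + y.2) * n.2); rewrite // /dotp; ring.
Qed.

Lemma dotpZl (R : realType) (t : R) (x n : R * R) :
  dotp (t *: x) n = t * dotp x n.
Proof.
by transitivity ((t * x.1) * n.1 + (t * x.2) * n.2); rewrite // /dotp; ring.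
Qed.

Lemma dotpBl (R : realType) (x y n : R * R) :
  dotp (x - y) n = dotp x n - dotp y n.
Proof. by rewrite -scaleN1r dotpDl dotpZl mulN1r. Qed.

Lemma continuous_dotp (R : realType) (n : R * R) :
  continuous (fun z : R * R => dotp z n).
Proof.
move=> z; apply: cvgD; apply: cvgM; try exact: cvg_cst.
- exact: cvg_fst.
- exact: cvg_snd.
Qed.

(* Shrinking [K] by [s] towards an interior point [c] shows that
   [(1 - s) *: (x - y)] lies in the interior of the support of [g_K]. *)
Lemma width_le_of_covariogram (R : realType) (A K : set (R * R)) (n : R * R)
    (l : R) :
  closed K -> convex_set K -> interior K !=set0 -> 0 <= l ->
  covariogram A = covariogram K ->
  (forall a b, A a -> A b -> dotp a n - dotp b n <= l) ->
  forall x y, K x -> K y -> dotp x n - dotp y n <= l.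
Proof.
move=> clK cK [c Kc] l0 gAK wA x y Kx Ky.
have [r /= r0 rK] : exists2 r, 0 < r & ball c r `<=` K.
  by move: Kc; rewrite /interior => /nbhs_ballP[r r0 rK]; exists r.
have shrink s : 0 < s < 1 -> (1 - s) * (dotp x n - dotp y n) <= l.
  move=> s01; pose d := (1 - s) *: (x - y).
  (* The homothety of centre [x0] and ratio [s] maps [ball c r] onto this ball, and by convexity it
     keeps points of [K] in [K]. *)
  have ballK x0 z : K x0 -> ball ((1 - s) *: x0 + s *: c) (s * r) z -> K z.
    move=> Kx0 xz.
    have -> : z = (1 - s) *: x0 + s *: (s^-1 *: (z - (1 - s) *: x0)).
      by rewrite scalerA divff ?scale1r 1?addrC ?subrK//; lra.
    apply: convex_set_comb => //; [|lra].
    apply: rK; move: xz; rewrite /ball/= /prod_ball /ball/=.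
    have E (u v w : R) : `|u - s^-1 * (w - (1 - s) * v)| < r =
        (`|(1 - s) * v + s * u - w| < s * r).
      have s0 : 0 < s by lra.
      have -> : u - s^-1 * (w - (1 - s) * v) =
          s^-1 * ((1 - s) * v + s * u - w) by field; rewrite gt_eqF.
      by rewrite normrM gtr0_norm ?invr_gt0// ltr_pdivrMl.
    by rewrite !E.
  (* The images of [x] and [y] under the shrinking differ by [d], so a ball around the first lies
     both in [K] and in its translate by [d]. *)
  have : (0 < covariogram A d)%E.
    have sr0 : 0 < s * r by case/andP: s01 => s0 _; exact: mulr_gt0.
    rewrite gAK.
    apply: (lt_le_trans (lebesgue2_ball_gt0 ((1 - s) *: x + s *: c) sr0)).
    apply: le_measure; rewrite ?inE.
    - exact: measurableX (measurable_ball _ _) (measurable_ball _ _).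
    - by apply: closed_measurable_prod; apply: closedI => //; exact: closed_translate.
    move=> z xz; split; first exact: ballK xz.
    rewrite translateE /=; apply: (ballK y) => //.
    move: xz; rewrite /ball/= /prod_ball /ball/= /d => -[].
    by split; [move: a|move: b]; rewrite ltr_norml => ?; rewrite ltr_norml /=; lra.
  (* Positive overlap yields [a] and [a - d] both in [A], so the width of [A] bounds [dotp d n]. *)
  have [[a [Aa]]|] := pselect (A `&` translate A d !=set0).
    rewrite translateE /= => Aad _; have := wA _ _ Aa Aad.
    by rewrite /d !(dotpBl, dotpZl) => ?; lra.
  by move=> /set0P/negP/negPn/eqP E0; rewrite /covariogram E0 measure0 ltxx.
rewrite leNgt; apply/negP; set D := dotp x n - dotp y n => lD.
have D0 : 0 < D by exact: le_lt_trans lD.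
(* This value of [s] makes [(1 - s) * D] the midpoint of [l] and [D], which exceeds [l]. *)
have := shrink ((D - l) / (2 * D)).
rewrite -/D.
have -> : (1 - (D - l) / (2 * D)) * D = (D + l) / 2 by field; rewrite gt_eqF.
have DD0 : 0 < 2 * D by exact: mulr_gt0.
have h1 : 0 < (D - l) / (2 * D) by apply: divr_gt0; rewrite ?subr_gt0.
have h2 : (D - l) / (2 * D) < 1.
  by rewrite ltr_pdivrMr// mul1r; lra.
by rewrite h1 h2 => /(_ isT); lra.
Qed.

(** * Coordinates adapted to the direction, and the projection *)

(** [(n, m)] is the basis dual to [(e, v)], whose determinant is [1] or [-1]. Taking [v]
    proportional to [u], not necessarily of unit length, reduces the change of coordinates to a swap
    and a shear. *)
Lemma adapted_coordinates (R : realType) (u : R * R) : dotp u u = 1 ->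
  exists e v n m : R * R, exists c : R,
  [/\ u = c *: v,
      [/\ dotp e n = 1, dotp e m = 0, dotp v n = 0 & dotp v m = 1],
      forall z, dotp z n *: e + dotp z m *: v = z &
      forall S, measurable (S : set (measurableTypeR R * measurableTypeR R)) ->
        lebesgue2 ((fun z => z.1 *: e + z.2 *: v) @^-1` S) = lebesgue2 S].
Proof.
have pairE (x y : R * R) : x.1 = y.1 -> x.2 = y.2 -> x = y.
  by case: x y => [? ?] [? ?] /= -> ->.
have combE (s t : R) (x y : R * R) :
  s *: x + t *: y = (s * x.1 + t * y.1, s * x.2 + t * y.2) by [].
case: u => a b; rewrite /dotp /= => u1.
have [a0|a0] := eqVneq a 0.
  exists (1, 0), (0, 1), (1, 0), (0, 1), b; split=> //=.
  - by rewrite a0; apply: pairE; rewrite /= /GRing.scale /=; ring.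
  - by split=> /=; ring.
  - by move=> z; rewrite combE; apply: pairE => /=; ring.
  move=> S mS; congr lebesgue2; apply/seteqP.
  by split=> z /=; rewrite combE /= !mulr1 !mulr0 addr0 add0r; case: z.
(* [v] is [u] rescaled to first coordinate [1]; the coordinate map is the swap followed by the shear
   of slope [b / a]. *)
exists (0, 1), (1, b / a), (- (b / a), 1), (1, 0), a; split=> //=.
- by apply: pairE; rewrite /= /GRing.scale /=; [ring|field].
- by split=> /=; ring.
- by move=> z; rewrite combE; apply: pairE => /=; ring.
move=> S mS; have [mS' <-] := lebesgue2_shear (b / a) mS.
have [_ <-] := lebesgue2_swap mS'.
congr lebesgue2; apply/seteqP.
have E (z : R * R) : z.1 *: (0, 1) + z.2 *: (1, b / a) =
    (z.2, z.1 + b / a * z.2) :> R * R.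
  by rewrite combE; apply: pairE => /=; ring.
by split=> z /=; rewrite E.
Qed.

(** As [n] lies in [perp u], projecting does not change [dotp z n], so the image is that of a
    segment under a linear form. *)
Lemma dotp_image_interval (R : realType) (A : set (R * R)) (u n : R * R) :
  dotp u u = 1 -> dotp u n = 0 -> is_segment (orth_proj A (perp u)) ->
  exists a b, a <= b /\ (fun z => dotp z n) @` A = `[a, b]%classic.
Proof.
move=> u1 un [p [q Epq]].
have [al [be [albe E]]] := image_comb_interval (dotp p n) (dotp q n).
exists al, be; split=> //; rewrite -E.
apply/seteqP; split=> [_ [x Ax <-]|_ [t t01 <-]].
  have : orth_proj A (perp u) (x - dotp x u *: u).
    split; first by rewrite /perp /= dotpBl dotpZl u1 mulr1 subrr.
    exists x => // z zu; rewrite opprB addrC subrK dotpZl.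
    by rewrite (dotpC u) (_ : dotp z u = 0) ?mulr0.
  rewrite Epq => -[t t01 tE]; exists t => //.
  have := congr1 (fun z => dotp z n) tE.
  by rewrite /= -scaleNr !dotpDl !dotpZl un mulr0 addr0.
have : orth_proj A (perp u) ((1 - t) *: p + t *: q) by rewrite Epq; exists t.
move=> [_ [x Ax xy]]; exists x => //.
have nu : perp u n by rewrite /perp /= dotpC.
by have := xy n nu; rewrite dotpBl dotpDl !dotpZl => /subr0_eq.
Qed.

(** The image of the interior misses only finitely many points of the interval, a null set. *)
Lemma le_measure_image_interior (R : realType) (A : set (R * R))
    (f : R * R -> R) (al be : R) :
  A = closure (interior A) -> finite_set (components (interior A)) ->
  continuous f -> f @` A = `[al, be]%classic -> al <= be ->
  measurable (f @` interior A) ->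
  ((be - al)%:E <= lebesgue_measure (f @` interior A))%E.
Proof.
move=> regA finA cf fA albe; set U := f @` interior A => mU.
pose Z := f @` A `\` U.
have cZ : countable Z.
  exact/finite_set_countable/finite_image_regular.
have mZ : measurable Z by exact: countable_measurable.
apply: (@le_trans _ _ (lebesgue_measure (U `|` Z))).
  have -> : (be - al)%:E = lebesgue_measure (`[al, be]%classic : set R).
    rewrite lebesgue_measure_itv /= lte_fin.
    have [lt|ge] := ltP al be; first by rewrite EFinB.
    by rewrite (_ : be = al) ?subrr//; apply/eqP; rewrite eq_le ge albe.
  apply: le_measure; rewrite ?inE//; first exact: measurableU.
  by rewrite -fA => y Ay; have [Uy|nUy] := pselect (U y); [left|right].
rewrite -[leRHS]adde0 -[X in (_ + X)%E](countable_lebesgue_measure0 cZ).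
exact: measureU2.
Qed.

(** * Comparison of the sweeps of [A] and [K] *)

Unset Implicit Arguments.

Theorem corollary3p6 (R : realType) (A : set (R * R))
  (cptA : compact A) (regA : regular A)
  (finA : finite_set (components (interior A)))
  (exA : exists u a1 a2 : R * R,
    [/\ unit_circle u,
        interior A a1 /\ interior A a2,
        is_segment (orth_proj A (perp u)),
        parallel (a2 - a1) u
      & segment a1 a2 `&` ~` A !=set0]) :
  forall K : set (R * R), convex_body K -> covariogram A <> covariogram K.
Proof.
move=> K [cptK cvxK intK] gAK.
have [u [a1 [a2 [u1 [Aa1 Aa2] segA [tau Etau] [a0 [[lam lam01 Elam] nAa0]]]]]] :=
  exA.
have [e [v [n [m [c [uE [en em vn vm] coordK mp]]]]]] := adapted_coordinates u1.
have clA : closed A by case: regA.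
have clK : closed K by apply: compact_closed.
pose Phi (z : R * R) : R * R := z.1 *: e + z.2 *: v.
have PhiK z : Phi (dotp z n, dotp z m) = z by exact: coordK.
have PhiDv y s t : Phi (y, s) + t *: v = Phi (y, s + t).
  by rewrite /Phi /= scalerDl addrA.
have PhiBv y s t : Phi (y, s) - t *: v = Phi (y, s - t).
  by rewrite -PhiDv scaleNr.
have wPhi y s : dotp (Phi (y, s)) n = y.
  by rewrite /Phi dotpDl !dotpZl en vn mulr1 mulr0 addr0.
have hPhi y s : dotp (Phi (y, s)) m = s.
  by rewrite /Phi dotpDl !dotpZl em vm mulr1 mulr0 add0r.
have cPhi : continuous Phi.
  by move=> z; apply: cvgD; apply: cvgZl; [exact: cvg_fst|exact: cvg_snd].
have cw := @continuous_dotp R n; have ch := @continuous_dotp R m.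
have un : dotp u n = 0 by rewrite uE dotpZl vn mulr0.
have [al [be [albe wA]]] := dotp_image_interval u1 un segA.
have l0 : 0 <= be - al by rewrite subr_ge0.
have wA_le x : A x -> al <= dotp x n <= be.
  move=> Ax; have : ((fun z => dotp z n) @` A) (dotp x n) by exists x.
  by rewrite wA /= in_itv.
have wK : forall x y, K x -> K y -> dotp x n - dotp y n <= be - al.
  apply: (@width_le_of_covariogram _ A) => // a b /wA_le/andP[? ?] /wA_le/andP[? ?].
  lra.
(* In adapted coordinates, the sections of [B] and [L] are the traces of [A] and [K] on the lines
   parallel to [u]. *)
pose B := Phi @^-1` A; pose L := Phi @^-1` K.
have clB : closed B by apply: closed_comp => // z _; exact: cPhi.
have clL : closed L by apply: closed_comp => // z _; exact: cPhi.
have mB := closed_measurable_prod clB.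
have mL := closed_measurable_prod clL.
have mPhi (S : set (R * R)) : closed S ->
    lebesgue2 (Phi @^-1` S) = lebesgue2 S.
  by move=> clS; apply: mp; exact: closed_measurable_prod.
have overlap (S : set (R * R)) t : closed S ->
    covariogram S (t *: v) = lebesgue2 (Phi @^-1` S `&`
      (fun z => (z.1, (z.2 - t)%R)) @^-1` (Phi @^-1` S)).
  move=> clS; rewrite /covariogram -mPhi; last first.
    by apply: closedI => //; exact: closed_translate.
  rewrite translateE; congr lebesgue2; apply/seteqP.
  by split=> -[y s] /=; rewrite PhiBv.
have vol (S : set (R * R)) : closed S ->
    covariogram S 0 = lebesgue2 (Phi @^-1` S).
  move=> clS; rewrite mPhi// /covariogram translateE; congr lebesgue2.
  by apply/seteqP; split=> z /=; rewrite subr0 // => -[].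
have bounded2 (S : set (R * R)) : compact S ->
    exists M, forall z, (Phi @^-1` S) z -> `|z.1| <= M /\ `|z.2| <= M.
  move=> cptS; have [M1 b1] := compact_bound cptS cw.
  have [M2 b2] := compact_bound cptS ch.
  exists (Num.max M1 M2) => -[y s] /= Sz; have := b1 _ Sz; have := b2 _ Sz.
  by rewrite wPhi hPhi !le_max => -> ->; rewrite orbT.
have [MA bA] := bounded2 _ cptA; have [MK bK] := bounded2 _ cptK.
have finB := lebesgue2_bounded mB bA.
have finL := lebesgue2_bounded mL bK.
(* Both integrals are the drop of the common covariogram from [0] to [t *: v]. *)
have sweep_eq t :
    (\int[lebesgue_measure]_y lebesgue_measure (advance t (xsection B y)) =
     \int[lebesgue_measure]_y lebesgue_measure (advance t (xsection L y)))%E.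
  have EB := lebesgue2_advance t mB finB.
  have EL := lebesgue2_advance t mL finL.
  rewrite -overlap// in EB; rewrite -overlap// in EL.
  rewrite -vol// in EB finB; rewrite -vol// -gAK in EL.
  rewrite EB in EL.
  (* Finiteness allows the overlap to be cancelled in the extended reals. *)
  have fin : covariogram A (t *: v) \is a fin_num.
    rewrite ge0_fin_numE; last exact: measure_ge0.
    apply: le_lt_trans finB; rewrite EB.
    by rewrite leeDl//; apply: integral_ge0.
  rewrite -[LHS](addeK _ fin) -[RHS](addeK _ fin); congr (_ - _)%E.
  by rewrite addeC EL addeC.
have [k0 Kk0] := intK; have {}Kk0 := interior_subset Kk0.
(* The covariogram does not fix the position of [K], so its projection starts at some [k]; only its
   width is controlled. *)
pose k := inf ((fun z => dotp z n) @` K).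
have wKk x : K x -> k <= dotp x n <= k + (be - al).
  move=> Kx; apply/andP; split.
    apply: ge_inf; last by exists x.
    by exists (dotp x n - (be - al)) => _ [y Ky <-]; have := wK _ _ Kx Ky; lra.
  rewrite -lerBlDr; apply: lb_le_inf; first by exists (dotp k0 n), k0.
  by move=> _ [y Ky <-]; have := wK _ _ Kx Ky; lra.
have upper t : 0 < t ->
    (\int[lebesgue_measure]_y lebesgue_measure (advance t (xsection L y)) <=
      (t * (be - al))%R%:E)%E.
  move=> t0; apply: (@sweep_upper_bound _ _ k _ MK) => //.
    move=> y s s' /set_mem Ls /set_mem Ls' r /andP[sr rs]; apply/mem_set.
    (* The convex combination below has parameter [(r - s) / (s' - s)], hence the separate
       degenerate case. *)
    have [ss|ss] := eqVneq s s'.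
      by rewrite (_ : r = s)//; apply/eqP; rewrite eq_le sr ss rs.
    have ss0 : 0 < s' - s.
      by rewrite subr_gt0 lt_neqAle ss (le_trans sr rs).
    have := @convex_set_comb _ _ _ _ ((r - s) / (s' - s)) cvxK Ls Ls'.
    rewrite /= (_ : _ + _ = Phi (y, r)).
      apply; rewrite divr_ge0 ?ler_pdivrMr ?mul1r ?lerD2r ?subr_ge0//.
      by rewrite -subr_ge0 ltW.
    rewrite -[LHS]PhiK !dotpDl !dotpZl !wPhi !hPhi; congr (Phi (_, _)).
      by ring.
    by field; rewrite gt_eqF.
  move=> [y s] Lz; split; first by have := wKk _ Lz; rewrite wPhi.
  by have [_] := bK _ Lz; rewrite ler_norml => /andP[].
pose U := (fun z => dotp z n) @` interior A.
pose line y s := Phi (y, s).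
have clines s : continuous (line^~ s).
  have : continuous (fun y : R => y *: e + s *: v).
    by move=> y; apply: cvgD; [apply: cvgZl; exact: cvg_id|exact: cvg_cst].
  exact.
have cline y : continuous (line y).
  have : continuous (fun s : R => y *: e + s *: v).
    by move=> s; apply: cvgD; [exact: cvg_cst|apply: cvgZl; exact: cvg_id].
  exact.
have intA z : interior A z -> A z by exact: interior_subset.
have oA : open (interior A) by exact: open_interior.
have oline O y : open O -> open (line y @^-1` O).
  by move=> oO; apply: open_comp => // s _; exact: cline.
have olines O s : open O -> open (line^~ s @^-1` O).
  by move=> oO; apply: open_comp => // y _; exact: clines.
(* Slicing at constant height writes [U] as a union of open sets, hence measurable. *)
have UE : U = \bigcup_(s in setT) (line^~ s @^-1` interior A).
  apply/seteqP; split=> [_ [z Az <-]|y [s _ Az]].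
    by exists (dotp z m) => //=; rewrite /line PhiK.
  by exists (line y s) => //; exact: wPhi.
have mU : measurable U.
  by apply: open_measurable; rewrite UE; apply: bigcup_open => s _; exact: olines.
have lU : ((be - al)%:E <= lebesgue_measure U)%E.
  by apply: le_measure_image_interior wA albe mU => //; case: regA.
have [s1 [s0 [s2 [y0 [s10 s02 Ay1 nAy0 Ay2]]]]] : exists s1 s0 s2 y0,
    [/\ s1 < s0, s0 < s2, interior A (line y0 s1), ~ A (line y0 s0) &
        interior A (line y0 s2)].
  have wa2 : dotp a2 n = dotp a1 n.
    by apply/subr0_eq; rewrite -dotpBl Etau dotpZl un mulr0.
  have wa0 : dotp a0 n = dotp a1 n.
    by rewrite -Elam dotpDl !dotpZl wa2; ring.
  have ha0 : dotp a0 m = (1 - lam) * dotp a1 m + lam * dotp a2 m.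
    by rewrite -Elam dotpDl !dotpZl.
  have lineK z : dotp z n = dotp a1 n -> line (dotp a1 n) (dotp z m) = z.
    by move=> <-; rewrite /line PhiK.
  (* A point of this line is determined by its height, and [a0] is outside [A]; this makes the
     inequalities between heights strict. *)
  have ne z : dotp z n = dotp a1 n -> interior A z -> dotp a0 m != dotp z m.
    move=> wz Az; apply/eqP => E; apply: nAa0; apply: intA.
    by rewrite -(lineK a0)// E lineK.
  have n1 := ne a1 erefl Aa1; have n2 := ne a2 wa2 Aa2.
  move: lam01; rewrite /= in_itv/= => lam01'.
  have [h12|h21] := leP (dotp a1 m) (dotp a2 m).
    exists (dotp a1 m), (dotp a0 m), (dotp a2 m), (dotp a1 n).
    rewrite !lineK// !lt_neqAle n2 (eq_sym (dotp a1 m)) n1 ha0.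
    by split=> //=; nra.
  exists (dotp a2 m), (dotp a0 m), (dotp a1 m), (dotp a1 n).
  rewrite !lineK// !lt_neqAle n1 (eq_sym (dotp a2 m)) n2 ha0.
  by split=> //=; nra.
(* The three heights found on one line are kept fixed; as [A] is closed, all three conditions are
   open in [y] and persist on nearby lines. *)
pose V := (line^~ s1 @^-1` interior A `&` line^~ s0 @^-1` ~` A) `&`
  line^~ s2 @^-1` interior A.
have oV : open V.
  by apply: openI; [apply: openI|]; apply: olines => //; exact: closed_openC.
have mV : measurable V by exact: open_measurable.
have Vy0 : V y0 by [].
have lV : (0 < lebesgue_measure V)%E.
  have /nbhs_ballP[r /= r0 rV] : nbhs y0 V by exact: open_nbhs_nbhs.
  apply: (@lt_le_trans _ _ (lebesgue_measure (ball y0 r))).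
    by rewrite lebesgue_measure_ball ?ltW// lte_fin mulrn_wgt0.
  by apply: le_measure; rewrite ?inE//; exact: measurable_ball.
have VU : V `<=` U by move=> y [_ Ay]; rewrite UE; exists s2.
have interval_around O y s : open O -> O (line y s) ->
    exists2 r, 0 < r & forall x, `|x - s| <= r -> O (line y x).
  by move=> oO Os; exact: (open_ball_cl (oline _ _ oO) Os).
have secB y s : xsection B y s = A (line y s).
  by rewrite /xsection/= /B /line propeqE; split=> [/set_mem|?]; last exact/mem_set.
have finBy y : (lebesgue_measure (xsection B y) < +oo)%E.
  apply: (@le_lt_trans _ _ (lebesgue_measure (`[- MA, MA]%classic : set R))).
    apply: le_measure; rewrite ?inE//; first exact: measurable_xsection.
    by move=> s /set_mem /bA[_]; rewrite ler_norml /= in_itv.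
  by rewrite lebesgue_measure_itv/=; case: ifP => _; exact: ltry.
have oneU y : U y -> exists a r, 0 < r /\ `[a, a + r] `<=` xsection B y.
  rewrite UE => -[s _ /(interval_around _ _ _ oA)[r r0 rA]].
  exists s, r; split=> // x; rewrite /= in_itv/= => xr; rewrite secB.
  by apply/intA/rA; rewrite ler_norml; lra.
have twoV y : V y -> exists a b p r, [/\ 0 < r, a + r < p <= b,
     `[a, a + r] `<=` xsection B y, `[b, b + r] `<=` xsection B y &
     forall s, p - r <= s < p -> ~ xsection B y s].
  move=> [[/(interval_around _ _ _ oA)[r1 r10 A1]]].
  move=> /(interval_around _ _ _ (closed_openC clA))[r3 r30 A3].
  move=> /(interval_around _ _ _ oA)[r2 r20 A2].
  (* [r1], [r2], [r3] are radii around [s1], [s2], [s0]; the last bound gives [s1 + r < s0]. The gap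
     is taken just below [p = s0]. *)
  pose r := Num.min (Num.min r1 r2) (Num.min r3 ((s0 - s1) / 2)).
  have r0 : 0 < r by rewrite !lt_min r10 r20 r30 divr_gt0// subr_gt0.
  have : r <= r by [].
  rewrite {2}/r !le_min => /andP[/andP[rr1 rr2] /andP[rr3 rr]].
  exists s1, s2, s0, r; split=> //.
  - by move: rr; rewrite ler_pdivlMr// => ?; lra.
  - move=> x; rewrite /= in_itv/= => xr; rewrite secB.
    by apply/intA/A1; rewrite ler_norml; lra.
  - move=> x; rewrite /= in_itv/= => xr; rewrite secB.
    by apply/intA/A2; rewrite ler_norml; lra.
  - by move=> x xr; rewrite secB; apply: A3; rewrite ler_norml; lra.
have := @sweep_lower_bound _ B U V (be - al) mB finBy mU mV VU oneU twoV.
move=> /(_ _)/wrap[].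
  by move=> t t0; rewrite sweep_eq; exact: upper.
(* [U] alone already has measure at least [be - al], so the positive measure of [V] exceeds the
   bound. *)
rewrite leNgt => /negP; apply.
apply: (lt_le_trans _ (leeD2r _ lU)).
by rewrite lteDl.
Qed.
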